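(* Let $M$ be a generic structure for the class $\mathcal{C}$ (as described in the context) and suppose $M\models R_n(\bar a,\bar b)$. Then the linear ordering induced by $K_n$ on the set of $E_n$-classes of $\{\bar c\in M : M\models K_n(\bar a,\bar c,\bar b)\}$ (namely, $\bar c$ precedes $\bar c'$ iff $K_n(\bar a,\bar c,\bar c')$) is dense and without endpoints.
   Context: Let $L=\{E_n,K_n,R_n : 2<n<\omega\}$ be a relational language, where $E_n$ and $R_n$ have arity $2n$ and $K_n$ has arity $3n$. All these relations hold only on tuples whose $n$-blocks consist of $n$ distinct elements, and their truth depends only on the underlying $n$-element sets of the blocks. Let $K$ be the class of finite $L$-structures $C$ such that for each $n$: (1) $E_n$ is an equivalence relation on the set ${C\choose n}$ of $n$-element subsets of $C$; (2) $R_n$ is irreflexive, respects $E_n$ (if $E_n(\bar x,\bar y)$, $E_n(\bar u,\bar w)$ and $R_n(\bar x,\bar u)$ then $R_n(\bar y,\bar w)$), and induces a partial injective function on ${C\choose n}/E_n$; (3) $K_n$ respects $E_n$ in each argument and induces a circular order on ${C\choose n}/E_n$; (4) $R_n(\bar x,\bar y)\wedge R_n(\bar y,\bar z)\to K_n(\bar x,\bar y,\bar z)$, and if $R_n(\bar v_i,\bar w_i)$ for $i=1,2,3$ then $K_n(\bar v_1,\bar v_2,\bar v_3)\leftrightarrow K_n(\bar w_1,\bar w_2,\bar w_3)$ (so $R_n$ is a partial automorphism of the circular order); (5) the partial function induced by $R_n$ extends to an injective function $f$ on some larger domain such that $f^n$ is the identity on its domain but $f^m(V)\ne V$ for every $V\in{C\choose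 n}/E_n$ and every $0<m<n$. A structure $A\in K$ is strong if for every $n$, either all elements of ${A\choose n}$ are pairwise $E_n$-equivalent, or for every $\bar a\in{A\choose n}$ there is a sequence $\bar a_1=\bar a,\bar a_2,\dots,\bar a_n$ of pairwise non-$E_n$-equivalent elements of ${A\choose n}$ with $R_n(\bar a_i,\bar a_{i+1})$ for $1\le i\le n-1$ and $R_n(\bar a_n,\bar a_1)$ (an $R_n$-cycle). Let $\mathcal{C}$ be the class of strong structures in $K$. A countable $L$-structure $M$ is generic for $\mathcal{C}$ if: $\mathcal{C}$ is exactly the class of finite substructures of $M$ that are strong (i.e. belong to $\mathcal{C}$); $M$ is the union of a chain of finite substructures belonging to $\mathcal{C}$; and whenever $A\subseteq M$ is a finite substructure in $\mathcal{C}$ and $A\subseteq B$ with $B\in\mathcal{C}$, $B$ embeds into $M$ over $A$ with image in $\mathcal{C}$. Such an $M$ exists, is $\aleph_0$-categorical, and every isomorphism between finite substructures of $M$ belonging to $\mathcal{C}$ extends to an automorphism of $M$. *)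

(* Defs.v *)
From mathcomp Require Import all_boot.
Set Implicit Arguments. Unset Strict Implicit. Unset Printing Implicit Defensive.

(* A 2n-ary relation is
   represented as a relation on pairs of n-blocks (n-tuples), a 3n-ary one on
   triples of n-blocks.  The components at n <= 2 are junk and are ignored by
   every definition below (they only ever get used for 2 < n). *)
Record Lstr := LStr {
  car : eqType;
  rE : forall n, n.-tuple car -> n.-tuple car -> Prop;
  rR : forall n, n.-tuple car -> n.-tuple car -> Prop;
  rK : forall n, n.-tuple car -> n.-tuple car -> n.-tuple car -> Prop }.

(* Language convention: relations hold only on tuples whose n-blocks consist of
   n distinct elements, and depend only on the underlying n-sets. *)
Definition Lwf (S : Lstr) : Prop :=
  forall n, 2 < n -> forall x y z x' y' z' : n.-tuple (car S),
    (rE x y -> uniq x /\ uniq y) /\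
    (rR x y -> uniq x /\ uniq y) /\
    (rK x y z -> [/\ uniq x, uniq y & uniq z]) /\
    (perm_eq x x' -> perm_eq y y' -> perm_eq z z' ->
       [/\ rE x y -> rE x' y', rR x y -> rR x' y' & rK x y z -> rK x' y' z']).

(* x is (a tuple listing) an element of (A choose n) *)
Definition inA (S : Lstr) (A : car S -> Prop) n (x : n.-tuple (car S)) : Prop :=
  uniq x /\ forall i, A (tnth x i).

Definition finite_on (S : Lstr) (A : car S -> Prop) : Prop :=
  exists s : seq (car S), forall x, A x -> x \in s.

Definition finite_str (S : Lstr) : Prop := finite_on (fun _ : car S => True).

Definition inK_on (S : Lstr) (A : car S -> Prop) : Prop :=
  forall n, 2 < n ->
  let I := @inA S A n in
  let E := @rE S n in let R := @rR S n in let K := @rK S n in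
  [/\ (forall x, I x -> E x x),
      (forall x y, I x -> I y -> E x y -> E y x) &
      (forall x y z, I x -> I y -> I z -> E x y -> E y z -> E x z)] /\
  (* (2) R_n irreflexive, respects E_n, partial injective function on classes *)
  [/\ (forall x, I x -> ~ R x x),
      (forall x y u w, I x -> I y -> I u -> I w ->
         E x y -> E u w -> R x u -> R y w),
      (forall x y y', I x -> I y -> I y' -> R x y -> R x y' -> E y y') &
      (forall x x' y, I x -> I x' -> I y -> R x y -> R x' y -> E x x')] /\
  (* (3) K_n respects E_n in each argument and is a circular order on classes *)
  [/\ (forall x y z x' y' z', I x -> I y -> I z -> I x' -> I y' -> I z' ->
         E x x' -> E y y' -> E z z' -> K x y z -> K x' y' z'),
      (forall x y z, I x -> I y -> I z -> K x y z -> K y z x),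
      (forall x y z, I x -> I y -> I z -> K x y z -> ~ K z y x),
      (forall x y z w, I x -> I y -> I z -> I w -> K x y z -> K x z w -> K x y w) &
      (forall x y z, I x -> I y -> I z -> ~ E x y -> ~ E y z -> ~ E x z ->
         K x y z \/ K z y x)] /\
  (* (4) R_n is a partial automorphism of the circular order *)
  (forall x y z, I x -> I y -> I z -> R x y -> R y z -> K x y z) /\
  (forall v1 v2 v3 w1 w2 w3, I v1 -> I v2 -> I v3 -> I w1 -> I w2 -> I w3 ->
     R v1 w1 -> R v2 w2 -> R v3 w3 -> (K v1 v2 v3 <-> K w1 w2 w3)) /\
  (* (5) the partial function induced by R_n on classes (classes embedded into a
     larger domain D via cls) extends to an injective f on D with f^n = id and
     f^m(V) <> V for every class V and 0 < m < n *)
  (exists (D : Type) (cls : n.-tuple (car S) -> D) (f : D -> D),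
     (forall x y, I x -> I y -> (cls x = cls y <-> E x y)) /\
     injective f /\
     (forall d, iter n f d = d) /\
     (forall x y, I x -> I y -> R x y -> f (cls x) = cls y) /\
     (forall x m, I x -> 0 < m < n -> iter m f (cls x) <> cls x)).

Definition strong_cond (S : Lstr) (A : car S -> Prop) : Prop :=
  forall n, 2 < n ->
  (forall x y, inA A x -> inA A y -> @rE S n x y) \/
  (forall x, inA A x -> exists s : nat -> n.-tuple (car S),
     [/\ s 0 = x,
         (forall i, i < n -> inA A (s i)),
         (forall i j, i < n -> j < n -> i <> j -> ~ rE (s i) (s j)),
         (forall i, i.+1 < n -> rR (s i) (s i.+1)) &
         rR (s n.-1) (s 0)]).

Definition strong_on (S : Lstr) (A : car S -> Prop) : Prop :=
  inK_on A /\ strong_cond A.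

Definition emb_on (S1 S2 : Lstr) (D : car S1 -> Prop) (f : car S1 -> car S2) : Prop :=
  (forall x y, D x -> D y -> f x = f y -> x = y) /\
  forall n, 2 < n -> forall x y z : n.-tuple (car S1),
    (forall i, D (tnth x i)) -> (forall i, D (tnth y i)) -> (forall i, D (tnth z i)) ->
    [/\ rE x y <-> rE (map_tuple f x) (map_tuple f y),
        rR x y <-> rR (map_tuple f x) (map_tuple f y) &
        rK x y z <-> rK (map_tuple f x) (map_tuple f y) (map_tuple f z)].

Definition in_C (B : Lstr) : Prop :=
  finite_str B /\ Lwf B /\ strong_on (fun _ : car B => True).

Definition generic (M : Lstr) : Prop :=
  Lwf M /\
  (exists c : car M -> nat, injective c) /\
  (forall B, in_C B -> exists g : car B -> car M, emb_on (fun _ => True) g) /\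
  (exists Ak : nat -> car M -> Prop,
     (forall k, finite_on (Ak k) /\ strong_on (Ak k)) /\
     (forall k x, Ak k x -> Ak k.+1 x) /\
     (forall x, exists k, Ak k x)) /\
  (forall A : car M -> Prop, finite_on A -> strong_on A ->
   forall B, in_C B -> forall e : car M -> car B, emb_on A e ->
   exists g : car B -> car M,
     emb_on (fun _ => True) g /\ (forall x, A x -> g (e x) = x) /\
     strong_on (fun y => exists b, g b = y)).

(* Main.v *)
Require Import Defs.
From Stdlib Require Import Classical ClassicalDescription PropExtensionality IndefiniteDescription.
From mathcomp Require Import all_boot zify.
Set Implicit Arguments. Unset Strict Implicit. Unset Printing Implicit Defensive.

(* Inside a finite strong substructure A of M containing a, b and the given
   points, K_n is a circular order of the E_n-classes, which yields the axioms
   of a strict linear order on the interval.  Density and the absence of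
   endpoints follow once every n-set u of A has an immediate successor d over A
   in M.  Such a d comes from the extension property applied to a strong
   extension B of A in which every E_m-class V of A is followed immediately by
   a new class V+; the new classes are carried by m-sets containing new points,
   one m-set with k+1 new points for the k-th member of a fixed R_m-cycle of A,
   so that B inherits R_m-cycles from A and is again strong.  Starting the
   R_n-cycle at u, the n-set with a single new point represents u+. *)

Record circ_axioms (T : Type) (I : T -> Prop) (E R : T -> T -> Prop)
    (K : T -> T -> T -> Prop) : Prop := CircAxioms {
  E_refl : forall x, I x -> E x x;
  E_sym : forall x y, I x -> I y -> E x y -> E y x;
  E_trans : forall x y z, I x -> I y -> I z -> E x y -> E y z -> E x z;
  R_irrefl : forall x, I x -> ~ R x x;
  R_compat : forall x y u w, I x -> I y -> I u -> I w ->
    E x y -> E u w -> R x u -> R y w;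
  R_functional : forall x y y', I x -> I y -> I y' -> R x y -> R x y' -> E y y';
  R_injective : forall x x' y, I x -> I x' -> I y -> R x y -> R x' y -> E x x';
  K_compat : forall x y z x' y' z', I x -> I y -> I z -> I x' -> I y' -> I z' ->
    E x x' -> E y y' -> E z z' -> K x y z -> K x' y' z';
  K_cycle : forall x y z, I x -> I y -> I z -> K x y z -> K y z x;
  K_asym : forall x y z, I x -> I y -> I z -> K x y z -> ~ K z y x;
  K_trans : forall x y z w, I x -> I y -> I z -> I w -> K x y z -> K x z w -> K x y w;
  K_total : forall x y z, I x -> I y -> I z -> ~ E x y -> ~ E y z -> ~ E x z ->
    K x y z \/ K z y x;
  RR_K : forall x y z, I x -> I y -> I z -> R x y -> R y z -> K x y z;
  R_K_iff : forall v1 v2 v3 w1 w2 w3, I v1 -> I v2 -> I v3 -> I w1 -> I w2 -> I w3 ->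
    R v1 w1 -> R v2 w2 -> R v3 w3 -> (K v1 v2 v3 <-> K w1 w2 w3) }.

Section CircAxiomsTheory.
Variables (T : Type) (I : T -> Prop) (E R : T -> T -> Prop) (K : T -> T -> T -> Prop).
Hypothesis HK : circ_axioms I E R K.

Lemma K_neqE x y z : I x -> I y -> I z -> K x y z -> [/\ ~ E x y, ~ E y z & ~ E x z].
Proof.
have neq12 x' y' z' : I x' -> I y' -> I z' -> K x' y' z' -> ~ E x' y'.
  move=> Ix Iy Iz Kxyz Exy.
  have Kyyz : K y' y' z'
    by apply: (K_compat HK Ix Iy Iz Iy Iy Iz Exy (E_refl HK Iy) (E_refl HK Iz) Kxyz).
  by apply: (K_asym HK Iy Iy Iz Kyyz); do 2 apply: (K_cycle HK) => //.
move=> Ix Iy Iz Kxyz; have Kyzx := K_cycle HK Ix Iy Iz Kxyz.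
split; [exact: (neq12 x y z) | exact: (neq12 y z x) |].
by move=> /(E_sym HK Ix Iz); apply: (neq12 z x y) => //; apply: (K_cycle HK).
Qed.

Lemma R_E_iff v1 v2 w1 w2 : I v1 -> I v2 -> I w1 -> I w2 -> R v1 w1 -> R v2 w2 ->
  E v1 v2 <-> E w1 w2.
Proof.
move=> I1 I2 J1 J2 R1 R2; split => Ev.
  exact: (R_functional HK I2 J1 J2 (R_compat HK I1 I2 J1 J1 Ev (E_refl HK J1) R1)).
exact: (R_injective HK I1 I2 J2 (R_compat HK I1 I1 J1 J2 (E_refl HK I1) Ev R1)).
Qed.

Lemma K_antisym_at x y z : I x -> I y -> I z -> K x y z -> ~ K x z y.
Proof.
by move=> Ix Iy Iz Kxyz /(K_cycle HK Ix Iz Iy); apply: (K_asym HK Ix Iy Iz).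
Qed.

Lemma K_total_at x y z : I x -> I y -> I z -> ~ E x y -> ~ E y z -> ~ E x z ->
  K x y z \/ K x z y.
Proof.
move=> Ix Iy Iz nxy nyz nxz.
case: (K_total HK Ix Iy Iz nxy nyz nxz) => [|Kzyx]; [by left | right].
by apply: (K_cycle HK Iy Ix Iz); apply: (K_cycle HK Iz Iy Ix).
Qed.

Lemma R_all_E x y : (forall x y, I x -> I y -> E x y) -> I x -> I y -> ~ R x y.
Proof.
move=> allE Ix Iy Rxy; apply: (R_irrefl HK Iy).
exact: (R_compat HK Ix Iy Iy Iy (allE _ _ Ix Iy) (E_refl HK Iy) Rxy).
Qed.

Lemma K_all_E x y z : (forall x y, I x -> I y -> E x y) -> I x -> I y -> I z -> ~ K x y z.
Proof. by move=> allE Ix Iy Iz /(K_neqE Ix Iy Iz) [nxy _ _]; apply/nxy/allE. Qed.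

End CircAxiomsTheory.

Definition succ_over (T : Type) (I : T -> Prop) (E : T -> T -> Prop)
    (K : T -> T -> T -> Prop) (u d : T) :=
  forall x y, I x -> I y ->
    [/\ K x u y -> K x d y, ~ E x u -> K x u d & ~ E u y -> K u d y].

Section Successors.
Variables (T : Type) (I : T -> Prop) (E R : T -> T -> Prop) (K : T -> T -> T -> Prop).
Hypothesis HK : circ_axioms I E R K.
Variables (a b c d : T) (Ia : I a) (Ib : I b) (Ic : I c) (Kacb : K a c b).

Lemma succ_over_after : succ_over I E K c d -> K a d b /\ K a c d.
Proof.
move=> dsucc; have [nEac _ _] := K_neqE HK Ia Ic Ib Kacb.
by have [Kadb Kacd _] := dsucc a b Ia Ib; split; [apply: Kadb | apply: Kacd].
Qed.

Lemma succ_over_before c' : I c' -> K a c c' -> succ_over I E K c d -> K a d c'.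
Proof. by move=> Ic' Kacc' dsucc; have [Kadc' _ _] := dsucc a c' Ia Ic'; apply: Kadc'. Qed.

Lemma succ_over_start : succ_over I E K a d -> K a d b /\ K a d c.
Proof.
move=> dsucc; have [nEac _ nEab] := K_neqE HK Ia Ic Ib Kacb.
have [_ _ Kadb] := dsucc a b Ia Ib; have [_ _ Kadc] := dsucc a c Ia Ic.
by split; [apply: Kadb | apply: Kadc].
Qed.

End Successors.

Section Doubling.
Variables (T : Type) (J : T -> Prop) (E R : T -> T -> Prop) (K : T -> T -> T -> Prop).
Hypothesis HK : circ_axioms J E R K.

Definition dbl_I (p : T * bool) := J p.1.
Definition dbl_E (p q : T * bool) := p.2 = q.2 /\ E p.1 q.1.
Definition dbl_R (p q : T * bool) := p.2 = q.2 /\ R p.1 q.1.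

(* Each class [V] is split into [(V, false)] immediately followed by [(V, true)];
   [dbl_step x y z] says that [x], [y] is such a pair and [z] lies elsewhere. *)
Definition dbl_step (x y z : T * bool) :=
  [/\ E x.1 y.1, x.2 = false, y.2 = true & ~ E y.1 z.1].
Definition dbl_K (x y z : T * bool) :=
  K x.1 y.1 z.1 \/ dbl_step x y z \/ dbl_step y z x \/ dbl_step z x y.

Ltac saturate_E := repeat match goal with
  | H : E ?a ?b, Ja : J ?a, Jb : J ?b |- _ =>
      lazymatch goal with
      | _ : E b a |- _ => fail
      | _ => have := E_sym HK Ja Jb H; intro end
  | H : E ?a ?b, H' : E ?b ?c, Ja : J ?a, Jb : J ?b, Jc : J ?c |- _ =>
      lazymatch goal with
      | _ : E a c |- _ => fail
      | _ => have := E_trans HK Ja Jb Jc H H'; intro end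
  end.

Ltac close_E := saturate_E; first [assumption | contradiction].

Lemma dbl_K_compat x y z x' y' z' :
  dbl_I x -> dbl_I y -> dbl_I z -> dbl_I x' -> dbl_I y' -> dbl_I z' ->
  dbl_E x x' -> dbl_E y y' -> dbl_E z z' -> dbl_K x y z -> dbl_K x' y' z'.
Proof.
case: x y z x' y' z' => [x f] [y g] [z h] [x' f'] [y' g'] [z' h'].
rewrite /dbl_I /dbl_E /dbl_K /dbl_step /= => Jx Jy Jz Jx' Jy' Jz'.
move=> [<- Exx'] [<- Eyy'] [<- Ezz'].
case=> [Kxyz|[[? ? ? ?]|[[? ? ? ?]|[? ? ? ?]]]].
- by left; apply: (K_compat HK Jx Jy Jz Jx' Jy' Jz' Exx' Eyy' Ezz').
- by right; left; split=> //; try move=> ?; close_E.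
- by right; right; left; split=> //; try move=> ?; close_E.
- by right; right; right; split=> //; try move=> ?; close_E.
Qed.

Lemma dbl_K_asym x y z : dbl_I x -> dbl_I y -> dbl_I z -> dbl_K x y z -> ~ dbl_K z y x.
Proof.
case: x y z => [x f] [y g] [z h]; rewrite /dbl_I /dbl_K /dbl_step /= => Jx Jy Jz.
case=> [Kxyz|[[? ? ? ?]|[[? ? ? ?]|[? ? ? ?]]]];
case=> [Kzyx|[[? ? ? ?]|[[? ? ? ?]|[? ? ? ?]]]]; subst => //.
all: try exact: (K_asym HK Jx Jy Jz Kxyz).
all: try by case: (K_neqE HK Jx Jy Jz Kxyz) => *; close_E.
all: try by case: (K_neqE HK Jz Jy Jx Kzyx) => *; close_E.
all: by close_E.
Qed.

Lemma dbl_K_trans x y z w : dbl_I x -> dbl_I y -> dbl_I z -> dbl_I w ->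
  dbl_K x y z -> dbl_K x z w -> dbl_K x y w.
Proof.
case: x y z w => [x f] [y g] [z h] [w k]; rewrite /dbl_I /dbl_K /dbl_step /=.
move=> Jx Jy Jz Jw.
case=> [Kxyz|[[? ? ? ?]|[[? ? ? ?]|[? ? ? ?]]]];
case=> [Kxzw|[[? ? ? ?]|[[? ? ? ?]|[? ? ? ?]]]]; subst => //.
all: try case: (K_neqE HK Jx Jy Jz Kxyz) => ? ? ?.
all: try case: (K_neqE HK Jx Jz Jw Kxzw) => ? ? ?.
all: try by exfalso; close_E.
all: first
  [ by left; apply: (K_trans HK Jx Jy Jz Jw)
  | by left; apply: (K_compat HK Jx Jy Jz Jx Jy Jw) => //;
       first [apply: (E_refl HK); assumption | close_E]
  | by left; apply: (K_compat HK Jx Jz Jw Jx Jy Jw) => //;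
       first [apply: (E_refl HK); assumption | close_E]
  | by right; left; split=> //; try move=> ?; close_E
  | by right; right; left; split=> //; try move=> ?; close_E
  | by right; right; right; split=> //; try move=> ?; close_E ].
Qed.

Lemma dbl_K_total x y z : dbl_I x -> dbl_I y -> dbl_I z ->
  ~ dbl_E x y -> ~ dbl_E y z -> ~ dbl_E x z -> dbl_K x y z \/ dbl_K z y x.
Proof.
case: x y z => [x f] [y g] [z h]; rewrite /dbl_I /dbl_E /dbl_K /dbl_step /=.
move=> Jx Jy Jz nxy nyz nxz.
case: (classic (E x y)) => Exy; case: (classic (E y z)) => Eyz;
case: (classic (E x z)) => Exz; try by exfalso; close_E.
all: case: f g h nxy nyz nxz => [] [] [] /= nxy nyz nxz.
all: try by exfalso; first [by apply: nxy | by apply: nyz | by apply: nxz].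
all: try by case: (K_total HK Jx Jy Jz Exy Eyz Exz) => ?; [left; left | right; left].
all: first
  [ by left; right; left; split=> //; try move=> ?; close_E
  | by left; right; right; left; split=> //; try move=> ?; close_E
  | by left; right; right; right; split=> //; try move=> ?; close_E
  | by right; right; left; split=> //; try move=> ?; close_E
  | by right; right; right; left; split=> //; try move=> ?; close_E
  | by right; right; right; right; split=> //; try move=> ?; close_E ].
Qed.

Lemma dbl_R_K_iff v1 v2 v3 w1 w2 w3 :
  dbl_I v1 -> dbl_I v2 -> dbl_I v3 -> dbl_I w1 -> dbl_I w2 -> dbl_I w3 ->
  dbl_R v1 w1 -> dbl_R v2 w2 -> dbl_R v3 w3 -> (dbl_K v1 v2 v3 <-> dbl_K w1 w2 w3).
Proof.
case: v1 v2 v3 w1 w2 w3 => [v1 f1] [v2 f2] [v3 f3] [w1 g1] [w2 g2] [w3 g3].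
rewrite /dbl_I /dbl_R /dbl_K /dbl_step /= => J1 J2 J3 J4 J5 J6 [<- R1] [<- R2] [<- R3].
have RE := fun a b c d Ja Jb Jc Jd Rac Rbd =>
  propositional_extensionality _ _ (@R_E_iff _ _ _ _ _ HK a b c d Ja Jb Jc Jd Rac Rbd).
rewrite (RE _ _ _ _ J1 J2 J4 J5 R1 R2) (RE _ _ _ _ J2 J3 J5 J6 R2 R3).
rewrite (RE _ _ _ _ J3 J1 J6 J4 R3 R1).
by rewrite (propositional_extensionality _ _ (R_K_iff HK J1 J2 J3 J4 J5 J6 R1 R2 R3)).
Qed.

Lemma circ_axioms_dbl : circ_axioms dbl_I dbl_E dbl_R dbl_K.
Proof.
constructor.
- by case=> x f Jx; split; last exact: (E_refl HK).
- by case=> x f [y g] Jx Jy [/= -> Exy]; split; last exact: (E_sym HK).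
- case=> x f [y g] [z h] Jx Jy Jz [/= -> Exy] [/= -> Eyz].
  by split; last exact: (E_trans HK Jx Jy).
- by case=> x f Jx [_ Rxx]; apply: (R_irrefl HK Jx).
- case=> x f [y g] [u h] [w k] Jx Jy Ju Jw [/= <- Exy] [/= <- Euw] [/= <- Rxu].
  by split; last exact: (R_compat HK Jx Jy Ju Jw).
- case=> x f [y g] [y' g'] Jx Jy Jy' [/= <- Rxy] [/= <- Rxy'].
  by split; last exact: (R_functional HK Jx Jy Jy').
- case=> x f [x' f'] [y g] Jx Jx' Jy [/= -> Rxy] [/= -> Rx'y].
  by split; last exact: (R_injective HK Jx Jx' Jy).
- exact: dbl_K_compat.
- move=> x y z Jx Jy Jz [Kxyz|[?|[?|?]]].
  + by left; apply: (K_cycle HK Jx Jy Jz).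
  + by do 3 right.
  + by right; left.
  + by do 2 right; left.
- exact: dbl_K_asym.
- exact: dbl_K_trans.
- exact: dbl_K_total.
- by case=> x f [y g] [z h] Jx Jy Jz [_ Rxy] [_ Ryz]; left; apply: (RR_K HK Jx Jy Jz).
- exact: dbl_R_K_iff.
Qed.

End Doubling.

Lemma circ_axioms_comap (T U : Type) (J : T -> Prop) (E R : T -> T -> Prop)
    (K : T -> T -> T -> Prop) (I P : U -> Prop) (q : U -> T) :
  (forall t, I t -> P t /\ J (q t)) -> circ_axioms J E R K ->
  circ_axioms I (fun x y => [/\ P x, P y & E (q x) (q y)])
    (fun x y => [/\ P x, P y & R (q x) (q y)])
    (fun x y z => [/\ P x, P y, P z & K (q x) (q y) (q z)]).
Proof.
move=> IPJ HK.
have P_ t : I t -> P t by move=> /IPJ [].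
have J_ t : I t -> J (q t) by move=> /IPJ [].
constructor.
- by move=> x Ix; split; auto; apply: (E_refl HK); auto.
- by move=> x y Ix Iy [_ _ Exy]; split; auto; apply: (E_sym HK); auto.
- move=> x y z Ix Iy Iz [_ _ Exy] [_ _ Eyz].
  by split; auto; apply: (E_trans HK _ _ _ Exy Eyz); auto.
- by move=> x Ix [_ _ Rxx]; apply: (R_irrefl HK (J_ _ Ix)).
- move=> x y u w Ix Iy Iu Iw [_ _ Exy] [_ _ Euw] [_ _ Rxu].
  by split; auto; apply: (R_compat HK _ _ _ _ Exy Euw Rxu); auto.
- move=> x y y' Ix Iy Iy' [_ _ Rxy] [_ _ Rxy'].
  by split; auto; apply: (R_functional HK _ _ _ Rxy Rxy'); auto.
- move=> x x' y Ix Ix' Iy [_ _ Rxy] [_ _ Rx'y].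
  by split; auto; apply: (R_injective HK _ _ _ Rxy Rx'y); auto.
- move=> x y z x' y' z' Ix Iy Iz Ix' Iy' Iz' [_ _ Exx'] [_ _ Eyy'] [_ _ Ezz'] [_ _ _ Kxyz].
  by split; auto; apply: (K_compat HK _ _ _ _ _ _ Exx' Eyy' Ezz' Kxyz); auto.
- by move=> x y z Ix Iy Iz [_ _ _ Kxyz]; split; auto; apply: (K_cycle HK); auto.
- by move=> x y z Ix Iy Iz [_ _ _ Kxyz] [_ _ _ Kzyx]; apply: (K_asym HK _ _ _ Kxyz Kzyx); auto.
- move=> x y z w Ix Iy Iz Iw [_ _ _ Kxyz] [_ _ _ Kxzw].
  by split; auto; apply: (K_trans HK _ _ _ _ Kxyz Kxzw); auto.
- move=> x y z Ix Iy Iz nxy nyz nxz.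
  have nE a b : I a -> I b -> ~ [/\ P a, P b & E (q a) (q b)] -> ~ E (q a) (q b).
    by move=> Ia Ib nab Eab; apply: nab; split; auto.
  have [Kxyz|Kzyx] := K_total HK (J_ _ Ix) (J_ _ Iy) (J_ _ Iz)
    (nE _ _ Ix Iy nxy) (nE _ _ Iy Iz nyz) (nE _ _ Ix Iz nxz).
  + by left; split; auto.
  + by right; split; auto.
- move=> x y z Ix Iy Iz [_ _ Rxy] [_ _ Ryz].
  by split; auto; apply: (RR_K HK _ _ _ Rxy Ryz); auto.
- move=> v1 v2 v3 w1 w2 w3 I1 I2 I3 I4 I5 I6 [_ _ R1] [_ _ R2] [_ _ R3].
  have [KvKw KwKv] :=
    R_K_iff HK (J_ _ I1) (J_ _ I2) (J_ _ I3) (J_ _ I4) (J_ _ I5) (J_ _ I6) R1 R2 R3.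
  by split=> [[_ _ _ /KvKw]|[_ _ _ /KwKv]]; split; auto.
Qed.

Lemma circ_axioms_trivial (U : Type) (I P : U -> Prop) :
  (forall t, I t -> P t) ->
  circ_axioms I (fun x y => P x /\ P y) (fun _ _ => False) (fun _ _ _ => False).
Proof. by move=> IP; constructor => //; auto. Qed.

Definition R_periodic (S : Lstr) (A : car S -> Prop) n : Prop :=
  exists (D : Type) (cls : n.-tuple (car S) -> D) (f : D -> D),
    (forall x y, inA A x -> inA A y -> (cls x = cls y <-> rE x y)) /\
    injective f /\
    (forall d, iter n f d = d) /\
    (forall x y, inA A x -> inA A y -> rR x y -> f (cls x) = cls y) /\
    (forall x m, inA A x -> 0 < m < n -> iter m f (cls x) <> cls x).

Lemma inK_onP (S : Lstr) (A : car S -> Prop) :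
  inK_on A <-> forall n, 2 < n ->
    circ_axioms (@inA S A n) (@rE S n) (@rR S n) (@rK S n) /\ R_periodic A n.
Proof.
split=> HA n n2; have := HA n n2.
  case=> [[? ? ?] [[? ? ? ?] [[? ? ? ? ?] [? [? ?]]]]]; split=> //; exact: CircAxioms.
by case=> [[? ? ? ? ? ? ? ? ? ? ? ? ? ?] ?].
Qed.

Definition all_E (S : Lstr) (A : car S -> Prop) m : Prop :=
  forall x y : m.-tuple (car S), inA A x -> inA A y -> rE x y.

Lemma inA_exists (S : Lstr) (A : car S -> Prop) m :
  ~ all_E A m -> exists x : m.-tuple (car S), inA A x.
Proof. by move=> ntriv; apply: NNPP => noA; apply: ntriv => x y Ax; case: noA; exists x. Qed.

Definition R_cycle (S : Lstr) (A : car S -> Prop) m (s : nat -> m.-tuple (car S)) :=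
  [/\ forall i, i < m -> inA A (s i),
      forall i j, i < m -> j < m -> i <> j -> ~ rE (s i) (s j),
      forall i, i.+1 < m -> rR (s i) (s i.+1) &
      rR (s m.-1) (s 0)].

Lemma strong_condP (S : Lstr) (A : car S -> Prop) :
  strong_cond A <-> forall n, 2 < n ->
    all_E A n \/ forall x : n.-tuple (car S), inA A x -> exists2 s, s 0 = x & R_cycle A s.
Proof.
split=> HA n n2; case: (HA n n2) => [trivA|cycA]; [by left | right | by left | right].
  by move=> x /cycA [s [s0 ? ? ? ?]]; exists s.
by move=> x /cycA [s s0 [? ? ? ?]]; exists s.
Qed.

Section RCycle.
Variables (S : Lstr) (A : car S -> Prop) (m : nat) (s : nat -> m.-tuple (car S)).
Hypothesis cyc_s : R_cycle A s.

Lemma R_cycle_step k : k < m -> rR (s k) (s (k.+1 %% m)).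
Proof.
case: cyc_s => _ _ Rstep Rlast km; case: (ltnP k.+1 m) => [k1m|].
  by rewrite modn_small //; apply: Rstep.
move=> mk1; have km1 : k = m.-1 by lia.
by rewrite km1 prednK ?modnn //; lia.
Qed.

Lemma R_cycle_rot j : 0 < m -> R_cycle A (fun i => s ((j + i) %% m)).
Proof.
move=> m0; case: cyc_s => inAs neqE _ _; split.
- by move=> i _; apply: inAs; rewrite ltn_mod.
- move=> i k im km ik; apply: neqE; rewrite ?ltn_mod // => /eqP.
  by rewrite eqn_modDl !modn_small // => /eqP.
- move=> i im; have := R_cycle_step (k := (j + i) %% m); rewrite ltn_mod => /(_ m0).
  by rewrite -addn1 modnDml addn1 addnS.
- have := R_cycle_step (k := (j + m.-1) %% m); rewrite ltn_mod => /(_ m0).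
  by rewrite -addn1 modnDml addn1 -addnS prednK // addn0 modnDr.
Qed.

End RCycle.

Lemma iter_ordS m (i : 'I_m) k : val (iter k (@ordS m) i) = (i + k) %% m.
Proof.
elim: k => [|k IH] /=; first by rewrite addn0 modn_small.
by rewrite IH -addn1 modnDml addn1 addnS.
Qed.

Lemma iter_map_fst (D B : Type) (f : D -> D) k (d : D) (b : B) :
  iter k (fun p : D * B => (f p.1, p.2)) (d, b) = (iter k f d, b).
Proof. by elim: k => //= k ->. Qed.

Lemma strong_circ_axioms (S : Lstr) (A : car S -> Prop) n : strong_on A -> 2 < n ->
  circ_axioms (@inA S A n) (@rE S n) (@rR S n) (@rK S n).
Proof. by move=> [KA _] n2; have [] := (inK_onP A).1 KA n n2. Qed.

Section Extension.
Variables (M : Lstr) (HL : Lwf M) (A : car M -> Prop) (HA : strong_on A).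
Variables (S : seq (car M)) (S_uniq : uniq S) (memS : forall x, x \in S <-> A x).
Variables (x0 : car M) (cyc : forall m, nat -> m.-tuple (car M)).
Hypothesis cycP : forall m, 2 < m -> ~ all_E A m -> R_cycle A (cyc m).

Local Notation N := (size S).

(* Old points are indexed by their position in [S]; [ext_pt] sends points outside
   [S] to a junk new point and [old_pt] sends new points to the junk [x0]. *)
Definition ext_car : eqType := ('I_N + 'I_N.+1)%type.
Definition is_new (b : ext_car) : bool := if b is inr _ then true else false.
Definition old_pt (b : ext_car) : car M := if b is inl i then nth x0 S i else x0.
Definition ext_pt (x : car M) : ext_car :=
  if insub (index x S) is Some i then inl i else inr ord0.

Lemma ext_pt_old x : x \in S -> is_new (ext_pt x) = false.
Proof. by move=> xS; rewrite /ext_pt insubT ?index_mem. Qed.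

Lemma old_ptK : {in S, cancel ext_pt old_pt}.
Proof. by move=> x xS; rewrite /ext_pt insubT ?index_mem //= => ?; rewrite nth_index. Qed.

Lemma ext_pt_inj : {in S &, injective ext_pt}.
Proof. exact: can_in_inj old_ptK. Qed.

Lemma ext_pt_nth (i : 'I_N) : ext_pt (nth x0 S i) = inl i.
Proof.
rewrite /ext_pt insubT; first by rewrite index_uniq.
by move=> ?; congr inl; apply: val_inj; rewrite /= index_uniq.
Qed.

Lemma old_pt_old b : ~~ is_new b -> ext_pt (old_pt b) = b /\ old_pt b \in S.
Proof. by case: b => // i _ /=; rewrite ext_pt_nth mem_nth. Qed.

Lemma ext_tuple_uniq m (x : m.-tuple (car M)) :
  (forall i, A (tnth x i)) -> uniq (map_tuple ext_pt x) = uniq x.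
Proof.
move=> Ax; rewrite map_inj_in_uniq // => a b /tnthP [i ->] /tnthP [j ->].
by apply: ext_pt_inj; apply/memS.
Qed.

(* An m-set containing k.+1 new points is a copy of the k-th member of the
   chosen R_m-cycle of A, placed immediately after it in the circular order. *)
Definition shadow m (x : m.-tuple ext_car) : m.-tuple (car M) :=
  if has is_new x then cyc m (count is_new x).-1 else map_tuple old_pt x.
Definition ext_rep m (x : m.-tuple ext_car) := (shadow x, has is_new x).

Definition all_Eb m : bool :=
  if excluded_middle_informative (all_E A m) then true else false.

Lemma all_EbP m : reflect (all_E A m) (all_Eb m).
Proof. by rewrite /all_Eb; case: excluded_middle_informative => ?; constructor. Qed.

Definition ext_E m (x y : m.-tuple ext_car) : Prop :=
  if all_Eb m then uniq x /\ uniq y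
  else [/\ uniq x, uniq y & dbl_E (@rE M m) (ext_rep x) (ext_rep y)].
Definition ext_R m (x y : m.-tuple ext_car) : Prop :=
  if all_Eb m then False
  else [/\ uniq x, uniq y & dbl_R (@rR M m) (ext_rep x) (ext_rep y)].
Definition ext_K m (x y z : m.-tuple ext_car) : Prop :=
  if all_Eb m then False
  else [/\ uniq x, uniq y, uniq z &
           dbl_K (@rE M m) (@rK M m) (ext_rep x) (ext_rep y) (ext_rep z)].

Definition ext_str : Lstr := LStr ext_E ext_R ext_K.

Lemma size_nontrivial m : ~ all_E A m -> m <= N.
Proof.
case/inA_exists => x [ux Ax]; rewrite -(size_tuple x).
by apply: uniq_leq_size => // z /tnthP [i ->]; apply/memS.
Qed.

Lemma pred_count_new_lt m (x : m.-tuple ext_car) :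
  has is_new x -> (count is_new x).-1 < m.
Proof.
rewrite has_count => cnt; have := count_size is_new x; rewrite size_tuple; lia.
Qed.

Lemma shadow_inA m (x : m.-tuple ext_car) :
  2 < m -> ~ all_E A m -> uniq x -> inA A (shadow x).
Proof.
move=> m2 ntriv ux; rewrite /shadow; case: ifP => [hnew | /negbT /hasPn old].
  by case: (cycP m2 ntriv) => inAc _ _ _; apply/inAc/pred_count_new_lt.
split.
  rewrite map_inj_in_uniq // => b b' bx b'x eb.
  by rewrite -(old_pt_old (old _ bx)).1 -(old_pt_old (old _ b'x)).1 eb.
by move=> i; rewrite tnth_map; apply/memS; apply: (old_pt_old _).2; apply/old/mem_tnth.
Qed.

Lemma has_new_ext m (y : m.-tuple (car M)) :
  (forall i, A (tnth y i)) -> has is_new (map_tuple ext_pt y) = false.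
Proof.
move=> Ay; apply/negbTE/hasPn => _ /mapP [z /tnthP [i ->] ->].
by rewrite ext_pt_old //; apply/memS.
Qed.

Lemma shadow_ext m (y : m.-tuple (car M)) :
  (forall i, A (tnth y i)) -> shadow (map_tuple ext_pt y) = y.
Proof.
move=> Ay; rewrite /shadow has_new_ext //; apply: eq_from_tnth => i.
by rewrite !tnth_map old_ptK //; apply/memS.
Qed.

Lemma perm_shadow m (x x' : m.-tuple ext_car) : perm_eq x x' ->
  has is_new x = has is_new x' /\ perm_eq (shadow x) (shadow x').
Proof.
move=> pxx'; have hnew := perm_has is_new pxx'; split => //.
by rewrite /shadow -hnew (permP pxx'); case: ifP => // _; rewrite perm_map.
Qed.

Lemma perm_rel_M m (x x' y y' z z' : m.-tuple (car M)) : 2 < m ->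
  perm_eq x x' -> perm_eq y y' -> perm_eq z z' ->
  [/\ rE x y = rE x' y', rR x y = rR x' y' & rK x y z = rK x' y' z'].
Proof.
move=> m2 px py pz.
have [E1 R1 K1] := (HL m2 x y z x' y' z').2.2.2 px py pz.
rewrite perm_sym in px; rewrite perm_sym in py; rewrite perm_sym in pz.
have [E2 R2 K2] := (HL m2 x' y' z' x y z).2.2.2 px py pz.
by split; apply: propositional_extensionality; split.
Qed.

Lemma perm_rel_ext m (x x' y y' z z' : m.-tuple ext_car) : 2 < m ->
  perm_eq x x' -> perm_eq y y' -> perm_eq z z' ->
  [/\ ext_E x y = ext_E x' y', ext_R x y = ext_R x' y' & ext_K x y z = ext_K x' y' z'].
Proof.
move=> m2 px py pz.
have [hx sx] := perm_shadow px; have [hy sy] := perm_shadow py.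
have [hz sz] := perm_shadow pz.
have [Exy Rxy Kxyz] := perm_rel_M m2 sx sy sz.
have [Eyz _ _] := perm_rel_M m2 sy sz sx; have [Ezx _ _] := perm_rel_M m2 sz sx sy.
rewrite /ext_E /ext_R /ext_K /dbl_E /dbl_R /dbl_K /dbl_step /ext_rep /=.
by rewrite (perm_uniq px) (perm_uniq py) (perm_uniq pz) hx hy hz Exy Rxy Kxyz Eyz Ezx.
Qed.

Lemma Lwf_ext : Lwf ext_str.
Proof.
move=> m m2 x y z x' y' z' /=; split; [|split; [|split]].
- by rewrite /ext_E; case: all_Eb => [[]|[]].
- by rewrite /ext_R; case: all_Eb => // [[]].
- by rewrite /ext_K; case: all_Eb => // [[]].
- by move=> px py pz; have [-> -> ->] := perm_rel_ext m2 px py pz.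
Qed.

Lemma circ_axioms_ext m : 2 < m ->
  circ_axioms (@inA ext_str (fun _ => True) m) (@rE ext_str m) (@rR ext_str m) (@rK ext_str m).
Proof.
move=> m2; rewrite /= /ext_E /ext_R /ext_K; case: all_EbP => [_|ntriv].
  by apply: circ_axioms_trivial => x [].
apply: (circ_axioms_comap (J := dbl_I (@inA M A m))) => [t [ut _]|].
  by split=> //; apply: shadow_inA.
exact/circ_axioms_dbl/strong_circ_axioms.
Qed.

Lemma R_periodic_ext m : 2 < m -> R_periodic (S := ext_str) (fun _ => True) m.
Proof.
move=> m2; have m0 : 0 < m by lia.
case: (all_EbP m) => [triv|ntriv].
  exists 'I_m, (fun _ => Ordinal m0), (@ordS m); split; [|split; [|split; [|split]]].
  - by move=> x y [ux _] [uy _]; rewrite /= /ext_E; case: all_EbP.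
  - exact: ordS_inj.
  - by move=> d; apply: val_inj; rewrite iter_ordS modnDr modn_small.
  - by move=> x y _ _; rewrite /= /ext_R; case: all_EbP.
  - move=> x j _ /andP [j0 jm] /(congr1 val); rewrite iter_ordS add0n modn_small //=.
    by move=> j_eq0; rewrite j_eq0 in j0.
have [_ [D [cls [f [clsE [f_inj [f_per [f_R f_ord]]]]]]]] := (inK_onP A).1 HA.1 m m2.
have inA_sh (x : m.-tuple ext_car) : inA (S := ext_str) (fun _ => True) x -> inA A (shadow x).
  by case=> ux _; apply: shadow_inA.
exists (D * bool)%type, (fun x => (cls (shadow x), has is_new x)), (fun p => (f p.1, p.2)).
split; [|split; [|split; [|split]]].
- move=> x y Ix Iy; rewrite /= /ext_E /dbl_E /ext_rep; case: all_EbP => // _ /=.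
  split=> [[/(clsE _ _ (inA_sh _ Ix) (inA_sh _ Iy)) Exy ->]|[_ _ [-> Exy]]].
    by split; [case: Ix | case: Iy | ].
  by congr pair; apply/(clsE _ _ (inA_sh _ Ix) (inA_sh _ Iy)).
- by move=> [d b] [d' b'] /= [/f_inj -> ->].
- by move=> [d b]; rewrite iter_map_fst f_per.
- move=> x y Ix Iy; rewrite /= /ext_R /dbl_R /ext_rep; case: all_EbP => // _ [_ _ [/= -> Rxy]].
  by rewrite (f_R _ _ (inA_sh _ Ix) (inA_sh _ Iy) Rxy).
- by move=> x j Ix hj; rewrite iter_map_fst => [[]]; apply: f_ord (inA_sh _ Ix) hj.
Qed.

Definition fresh_pt k (i : nat) : ext_car :=
  if i <= k then inr (inord i) else ext_pt (nth x0 S i).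

Definition fresh_tuple m k : m.-tuple ext_car :=
  Tuple (introT eqP (size_mkseq (fresh_pt k) m)).

Lemma fresh_uniq m k : m <= N -> uniq (fresh_tuple m k).
Proof.
move=> mN; rewrite /= map_inj_in_uniq ?iota_uniq // => i j.
rewrite !mem_iota !add0n => im jm; rewrite /fresh_pt.
have iS : nth x0 S i \in S by rewrite mem_nth //; lia.
have jS : nth x0 S j \in S by rewrite mem_nth //; lia.
case: ifP => _; case: ifP => _.
- by move=> [] /(congr1 val); rewrite /= !inordK //; lia.
- by move=> /(congr1 is_new); rewrite ext_pt_old.
- by move=> /(congr1 is_new); rewrite ext_pt_old.
- by move=> /(ext_pt_inj iS jS) /eqP; rewrite nth_uniq //; [move/eqP | lia | lia].
Qed.

Lemma count_fresh m k : k < m -> m <= N -> count is_new (fresh_tuple m k) = k.+1.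
Proof.
move=> km mN; rewrite /= count_map (@eq_in_count _ _ (fun i => i < 0 + k.+1)).
  by rewrite -size_filter filter_iota_ltn ?size_iota.
move=> i; rewrite mem_iota add0n => /andP [_ im] /=; rewrite /fresh_pt ltnS.
by case: ifP => // _; rewrite ext_pt_old // mem_nth //; lia.
Qed.

Lemma ext_rep_fresh m k : k < m -> m <= N -> ext_rep (fresh_tuple m k) = (cyc m k, true).
Proof.
move=> km mN; have hnew : has is_new (fresh_tuple m k) by rewrite has_count count_fresh.
by rewrite /ext_rep /shadow hnew count_fresh.
Qed.

Lemma R_cycle_ext m (sg : nat -> m.-tuple (car M)) (b : bool) (s : nat -> m.-tuple ext_car) :
  ~ all_E A m -> 0 < m -> R_cycle A sg ->
  (forall i, i < m -> uniq (s i) /\ ext_rep (s i) = (sg i, b)) ->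
  R_cycle (S := ext_str) (fun _ => True) s.
Proof.
move=> ntriv m0 [_ neqE Rstep Rlast] s_sg; rewrite /R_cycle /= /ext_E /ext_R.
case: all_EbP => // _; split.
- by move=> i /s_sg [].
- move=> i j im jm ij; have [_ ->] := s_sg i im; have [_ ->] := s_sg j jm.
  by move=> [_ _ [_ /(neqE i j im jm ij)]].
- move=> i im; have [ui ->] := s_sg i (ltnW im); have [ui1 ->] := s_sg i.+1 im.
  by split=> //; split=> //; apply: Rstep.
- have mlast : m.-1 < m by rewrite ltn_predL.
  by have [ulast ->] := s_sg m.-1 mlast; have [u0 ->] := s_sg 0 m0.
Qed.

Lemma strong_ext : strong_cond (S := ext_str) (fun _ => True).
Proof.
apply/strong_condP => m m2; case: (all_EbP m) => [triv|ntriv].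
  by left => x y [ux _] [uy _]; rewrite /= /ext_E; case: all_EbP.
right => x [ux _]; have m0 : 0 < m by lia.
case hx: (has is_new x).
- pose j := (count is_new x).-1; have jm : j < m := pred_count_new_lt hx.
  exists (fun i => if i == 0 then x else fresh_tuple m ((j + i) %% m)) => //.
  apply: (R_cycle_ext (sg := fun i => cyc m ((j + i) %% m)) (b := true)) => //.
    exact: R_cycle_rot (cycP m2 ntriv) _ m0.
  move=> i im; case: eqP => [->|_].
    by rewrite /ext_rep /shadow hx addn0 modn_small.
  by rewrite fresh_uniq ?ext_rep_fresh ?ltn_mod //; apply: size_nontrivial.
- case: ((strong_condP A).1 HA.2 m m2) => [//|cycA].
  have [sg sg0 cyc_sg] := cycA _ (shadow_inA m2 ntriv ux).
  exists (fun i => if i == 0 then x else map_tuple ext_pt (sg i)) => //.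
  apply: (R_cycle_ext (sg := sg) (b := false)) => //.
  move=> i im; case: eqP => [->|_]; first by rewrite /ext_rep hx sg0.
  case: cyc_sg => /(_ i im) [usg Asg] _ _ _.
  by rewrite ext_tuple_uniq // /ext_rep has_new_ext // shadow_ext.
Qed.

Lemma in_C_ext : in_C ext_str.
Proof.
split; last split.
- exists ([seq inl i | i <- enum 'I_N] ++ [seq inr i | i <- enum 'I_N.+1] : seq ext_car).
  by case=> i _; rewrite mem_cat map_f ?mem_enum ?orbT.
- exact: Lwf_ext.
- split; last exact: strong_ext.
  by apply/inK_onP => m m2; split; [exact: circ_axioms_ext | exact: R_periodic_ext].
Qed.

Local Notation ext := (map_tuple ext_pt).

Lemma emb_ext_pt : emb_on (S2 := ext_str) A ext_pt.
Proof.
split=> [x y Ax Ay|m m2 x y z Ax Ay Az]; first by apply: ext_pt_inj; apply/memS.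
have [uE uR uK] :
    [/\ rE x y -> uniq x /\ uniq y, rR x y -> uniq x /\ uniq y
      & rK x y z -> [/\ uniq x, uniq y & uniq z]].
  by have [? [? [? _]]] := HL m2 x y z x y z.
rewrite /= /ext_E /ext_R /ext_K /dbl_E /dbl_R /dbl_K /dbl_step /ext_rep /=.
rewrite !has_new_ext // !shadow_ext // !ext_tuple_uniq //.
have HKA := strong_circ_axioms HA m2.
case: all_EbP => [triv|ntriv].
- split; first by split=> [/uE //|[ux uy]]; apply: triv.
    by split=> // /[dup] /uR [ux uy]; apply: (R_all_E HKA triv); split.
  by split=> // /[dup] /uK [ux uy uz]; apply: (K_all_E HKA triv); split.
- split; first by split=> [/[dup] /uE [ux uy] ?|[? ? [_ ?]]].
    by split=> [/[dup] /uR [ux uy] ?|[? ? [_ ?]]].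
  split=> [/[dup] /uK [ux uy uz] ?|[_ _ _ Kd]]; first by split=> //; left.
  by case: Kd => [//|[[? ? ? ?]|[[? ? ? ?]|[? ? ? ?]]]].
Qed.

Lemma ext_succ n (u x y : n.-tuple (car M)) :
  2 < n -> ~ all_E A n -> inA A u -> cyc n 0 = u -> inA A x -> inA A y ->
  [/\ rK x u y -> ext_K (ext x) (fresh_tuple n 0) (ext y),
      ~ rE x u -> ext_K (ext x) (ext u) (fresh_tuple n 0) &
      ~ rE u y -> ext_K (ext u) (fresh_tuple n 0) (ext y)].
Proof.
move=> n2 ntriv Iu cyc_u Ix Iy; have HKA := strong_circ_axioms HA n2.
move: (Iu) (Ix) (Iy) => [uu Au] [ux Ax] [uy Ay].
have nN := size_nontrivial ntriv.
rewrite /ext_K /dbl_K /dbl_step; case: all_EbP => // _.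
rewrite ext_rep_fresh ?cyc_u //; last by lia.
rewrite /ext_rep !has_new_ext // !shadow_ext // !ext_tuple_uniq // fresh_uniq //=.
split=> [Kxuy | nxu | nuy]; split=> //.
- by left.
- do 2 right; left; split=> //; first exact: (E_refl HKA Iu).
  by move/(E_sym HKA Iu Ix).
- by right; left; split=> //; apply: (E_refl HKA Iu).
Qed.

End Extension.

Lemma finite_on_enum (S : Lstr) (A : car S -> Prop) :
  finite_on A -> exists2 s, uniq s & forall x, x \in s <-> A x.
Proof.
case=> s0 As0; pose Ab x := if excluded_middle_informative (A x) then true else false.
exists [seq x <- undup s0 | Ab x]; first by rewrite filter_uniq ?undup_uniq.
move=> x; rewrite mem_filter mem_undup /Ab.
by case: excluded_middle_informative => Ax; split=> // _; rewrite As0.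
Qed.

Lemma cycle_choice (S : Lstr) (A : car S -> Prop) n (u : n.-tuple (car S)) :
  strong_on A -> 2 < n -> ~ all_E A n -> inA A u ->
  exists cyc : forall m, nat -> m.-tuple (car S),
    (forall m, 2 < m -> ~ all_E A m -> R_cycle A (cyc m)) /\ cyc n 0 = u.
Proof.
move=> [_ /strong_condP sA] n2 ntriv Iu; have n0 : 0 < n by lia.
have cyc_m m : exists s : nat -> m.-tuple (car S),
    (2 < m -> ~ all_E A m -> R_cycle A s) /\ forall e : n = m, s 0 = tcast e u.
  case: (eqVneq n m) => [<-|nm].
    have [//|cycA] := sA n n2; have [s s0 cs] := cycA u Iu.
    by exists s; split=> // e; rewrite s0 tcast_id.
  have neq_nm (e : n = m) : False by move: nm; rewrite e eqxx.
  case: (classic (2 < m /\ ~ all_E A m)) => [[m2 ntm]|nc].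
    have [x Ix] := inA_exists ntm; have [//|cycA] := sA m m2.
    have [s _ cs] := cycA x Ix; exists s.
    by split=> // e; case: (neq_nm e).
  exists (fun _ => [tuple of nseq m (tnth u (Ordinal n0))]).
  by split=> [m2 ntm|e]; [case: nc | case: (neq_nm e)].
exists (fun m => proj1_sig (constructive_indefinite_description _ (cyc_m m))); split.
  by move=> m; have [] := proj2_sig (constructive_indefinite_description _ (cyc_m m)).
have [_ /(_ erefl)] := proj2_sig (constructive_indefinite_description _ (cyc_m n)).
by rewrite tcast_id.
Qed.

Lemma generic_succ (M : Lstr) (A : car M -> Prop) n (u : n.-tuple (car M)) :
  generic M -> finite_on A -> strong_on A -> 2 < n -> ~ all_E A n -> inA A u ->
  exists d, succ_over (@inA M A n) (@rE M n) (@rK M n) u d.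
Proof.
move=> [HL [_ [_ [_ extension]]]] fA sA n2 ntriv Iu; have n0 : 0 < n by lia.
have [S S_uniq memS] := finite_on_enum fA.
have [cyc [cycP cyc_u]] := cycle_choice sA n2 ntriv Iu.
pose x0 := tnth u (Ordinal n0).
have [g [[_ emb_g] [g_ext _]]] := extension A fA sA _ (in_C_ext HL sA S_uniq memS x0 cycP)
  _ (emb_ext_pt HL sA memS x0 cyc).
have gK (x : n.-tuple (car M)) : inA A x -> map_tuple g (map_tuple (ext_pt S) x) = x.
  by case=> _ Ax; apply: eq_from_tnth => i; rewrite !tnth_map g_ext.
have g_K X Y Z : @rK (ext_str A S x0 cyc) n X Y Z ->
    rK (map_tuple g X) (map_tuple g Y) (map_tuple g Z).
  by have [_ _ ->] := emb_g n n2 X Y Z (fun _ => I) (fun _ => I) (fun _ => I).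
exists (map_tuple g (fresh_tuple S x0 n 0)) => x y Ix Iy.
have [Kd1 Kd2 Kd3] := ext_succ sA S_uniq memS x0 n2 ntriv Iu cyc_u Ix Iy.
by split=> [/Kd1|/Kd2|/Kd3] /g_K; rewrite !gK.
Qed.

Lemma generic_cover (M : Lstr) n (ts : seq (n.-tuple (car M))) :
  generic M -> all (fun t : n.-tuple (car M) => uniq t) ts ->
  exists A, [/\ finite_on A, strong_on A & forall t, t \in ts -> inA A t].
Proof.
move=> [_ [_ [_ [[Ak [AkP [Ak_mono Ak_cover]]] _]]]] /allP uts.
have mono k k' x : k <= k' -> Ak k x -> Ak k' x.
  move=> kk'; rewrite -(subnKC kk'); elim: (k' - k) => [|j IH]; rewrite ?addn0 // addnS.
  by move=> /IH /Ak_mono.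
have [k Hk] : exists k, forall x, x \in flatten [seq val t | t <- ts] -> Ak k x.
  elim: (flatten _) => [|x s [k Hk]]; first by exists 0.
  have [k1 Hk1] := Ak_cover x.
  exists (maxn k k1) => y; rewrite in_cons => /predU1P [->|ys].
    by apply: mono Hk1; apply: leq_maxr.
  by apply: mono (Hk _ ys); apply: leq_maxl.
have [fA sA] := AkP k; exists (Ak k); split=> // t tts; split; first exact: uts.
by move=> i; apply: Hk; apply/flatten_mapP; exists t => //; apply: mem_tnth.
Qed.

Lemma generic_local (M : Lstr) n (a b c c' c'' : n.-tuple (car M)) :
  generic M -> 2 < n -> rR a b -> rK a c b -> rK a c' b -> rK a c'' b ->
  exists A, [/\ circ_axioms (@inA M A n) (@rE M n) (@rR M n) (@rK M n),
    forall u, inA A u -> exists d, succ_over (@inA M A n) (@rE M n) (@rK M n) u d &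
    [/\ inA A a, inA A b, inA A c, inA A c' & inA A c'']].
Proof.
move=> HM n2 Rab; have uK e : rK a e b -> uniq e by move=> /((HM.1 n n2 a e b a e b).2.2.1) [].
have [ua ub] := (HM.1 n n2 a b a a b a).2.1 Rab.
move=> /uK uc /uK uc' /uK uc''.
have [|A [fA sA inAts]] := generic_cover (ts := [:: a; b; c; c'; c'']) HM.
  by rewrite /= ua ub uc uc' uc''.
have HK := strong_circ_axioms sA n2.
have Ia : inA A a by apply: inAts; rewrite inE eqxx.
have Ib : inA A b by apply: inAts; rewrite !inE eqxx orbT.
exists A; split=> //; last by split; apply: inAts; rewrite !inE eqxx ?orbT.
move=> u Iu; apply: generic_succ HM fA sA n2 _ Iu => triv.
exact: (R_all_E HK triv Ia Ib Rab).
Qed.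

Theorem lemma2p1 (M : Lstr) (HM : generic M) (n : nat) (Hn : 2 < n)
  (a b : n.-tuple (car M)) (Hab : rR a b) :
  (* the order c < c' :<-> K_n(a,c,c') on {c | K_n(a,c,b)} modulo E_n *)
  (* strict linear order on the E_n-classes *)
  (forall c, rK a c b -> ~ rK a c c) /\
  (forall c c', rK a c b -> rK a c' b -> rK a c c' -> ~ rK a c' c) /\
  (forall c c' c'', rK a c b -> rK a c' b -> rK a c'' b ->
     rK a c c' -> rK a c' c'' -> rK a c c'') /\
  (forall c c', rK a c b -> rK a c' b -> ~ rE c c' -> rK a c c' \/ rK a c' c) /\
  (* dense *)
  (forall c c', rK a c b -> rK a c' b -> rK a c c' ->
     exists d, [/\ rK a d b, rK a c d & rK a d c']) /\
  (* no least element *)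
  (forall c, rK a c b -> exists d, rK a d b /\ rK a d c) /\
  (* no greatest element *)
  (forall c, rK a c b -> exists d, rK a d b /\ rK a c d).
Proof.
have local := generic_local HM Hn Hab.
split; [|split; [|split; [|split; [|split; [|split]]]]].
- move=> c Kc; have [A [HK _ [Ia _ Ic _ _]]] := local c c c Kc Kc Kc.
  by move=> /(K_neqE HK Ia Ic Ic) [_ /(_ (E_refl HK Ic))].
- move=> c c' Kc Kc'; have [A [HK _ [Ia _ Ic Ic' _]]] := local c c' c' Kc Kc' Kc'.
  exact: (K_antisym_at HK Ia Ic Ic').
- move=> c c' c'' Kc Kc' Kc''.
  have [A [HK _ [Ia _ Ic Ic' Ic'']]] := local c c' c'' Kc Kc' Kc''.
  exact: (K_trans HK Ia Ic Ic' Ic'').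
- move=> c c' Kc Kc' nEcc'; have [A [HK _ [Ia Ib Ic Ic' _]]] := local c c' c' Kc Kc' Kc'.
  have [nEac _ _] := K_neqE HK Ia Ic Ib Kc; have [nEac' _ _] := K_neqE HK Ia Ic' Ib Kc'.
  exact: (K_total_at HK Ia Ic Ic' nEac nEcc' nEac').
- move=> c c' Kc Kc' Kcc'; have [A [HK succ [Ia Ib Ic Ic' _]]] := local c c' c' Kc Kc' Kc'.
  have [d dsucc] := succ c Ic; have [Kadb Kacd] := succ_over_after HK Ia Ib Ic Kc dsucc.
  by exists d; split=> //; apply: (succ_over_before Ia Ic' Kcc' dsucc).
- move=> c Kc; have [A [HK succ [Ia Ib Ic _ _]]] := local c c c Kc Kc Kc.
  by have [d /(succ_over_start HK Ia Ib Ic Kc)] := succ a Ia; exists d.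
- move=> c Kc; have [A [HK succ [Ia Ib Ic _ _]]] := local c c c Kc Kc Kc.
  by have [d /(succ_over_after HK Ia Ib Ic Kc)] := succ c Ic; exists d.
Qed.
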